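(* Let $s\in\mathbb{Q}\setminus\{0,\pm1\}$ and let $(\alpha,\beta)\in E_{1,s}(\mathbb{Q})$ be a rational point which is not a torsion point. Let \[ t=\frac{s\alpha-2s(s^2-1)}{\alpha+2s^2(s^2-1)},\qquad \gamma=t^2\Bigl(s-\frac{1}{s}\Bigr)^2 . \] Then there exists a rational face cuboid $ABCD\text{-}EFGH$ with $BF=2|t|$, $EF=|t^2-1|$ and $HF=\sqrt{\gamma}$.
   Context: For $s\in\mathbb{Q}\setminus\{0,\pm1\}$, $E_{1,s}$ is the elliptic curve over $\mathbb{Q}$ given by $y^2=x(x-(2s)^2)(x+(s^2-1)^2)$. A cuboid $ABCD\text{-}EFGH$ is a rectangular box whose vertices are labeled so that $ABCD$ and $EFGH$ are opposite rectangular faces with $A,B,C,D$ adjacent (by an edge) to $E,F,G,H$ respectively; thus the three edges at $F$ are $FB$, $FE$, $FG$, the segment $BE$ is a diagonal of the face $ABFE$, $HF$ is a diagonal of the face $EFGH$, and $DF$ is a space diagonal. A rational face cuboid is such a cuboid (with positive edge lengths) in which the edges $BF,EF,FG$, the face diagonals $BE$ and $HF$, and the space diagonal $DF$ all have rational length. *)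

(* Defs.v *)
From HB Require Import structures.
From mathcomp Require Import all_boot all_order all_algebra.
From mathcomp Require Import reals.

Set Implicit Arguments.
Unset Strict Implicit.
Unset Printing Implicit Defensive.

Import Order.TTheory GRing.Theory Num.Theory.
Local Open Scope ring_scope.

(* Points of a projective curve y^2 = f(x), with f a monic cubic; ECinf is the
   point at infinity. *)
Variant ecpoint (K : Type) : Type := ECinf | ECaff of K & K.
Arguments ECinf {K}.

Section EllipticCurve.
Variables (K : fieldType) (f : {poly K}).

Definition on_curve (P : ecpoint K) : Prop :=
  if P is ECaff x y then y ^+ 2 = f.[x] else True.

(* Chord-tangent law for f monic of degree 3 and 2 != 0 in K: the line of slope
   l through two points of the curve meets it in a third point of abscissa
   l^2 - f`_2 - x1 - x2.  Meaningful only for points on the curve. *)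
Definition ec_chord (l x1 y1 x2 : K) : ecpoint K :=
  let x3 := l ^+ 2 - f`_2 - x1 - x2 in ECaff x3 (l * (x1 - x3) - y1).

Definition ec_add (P Q : ecpoint K) : ecpoint K :=
  match P, Q with
  | ECinf, _ => Q
  | _, ECinf => P
  | ECaff x1 y1, ECaff x2 y2 =>
      if x1 != x2 then ec_chord ((y2 - y1) / (x2 - x1)) x1 y1 x2
      else if y1 == - y2 then ECinf
      else ec_chord (f^`().[x1] / (2 * y1)) x1 y1 x2
  end.

Definition ec_mul (n : nat) (P : ecpoint K) : ecpoint K :=
  iter n (ec_add P) ECinf.

Definition ec_torsion (P : ecpoint K) : Prop :=
  exists2 n : nat, (0 < n)%N & ec_mul n P = ECinf.

End EllipticCurve.

Definition E1 (s : rat) : {poly rat} :=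
  'X * ('X - ((2 * s) ^+ 2)%:P) * ('X + ((s ^+ 2 - 1) ^+ 2)%:P).

Section Cuboid.
Variable R : realType.
Implicit Types u v A B C D E F G H : 'rV[R]_3.

Definition dotp u v : R := \sum_i u 0 i * v 0 i.

Definition dist A B : R := Num.sqrt (dotp (B - A) (B - A)).

(* A, B, C, D are the vertices in cyclic order. *)
Definition rectangle A B C D : Prop :=
  [/\ A != B, A != D, C - B = D - A & dotp (B - A) (D - A) = 0].

(* A right prism over ABCD whose lateral edges are AE, BF, CG, DH. *)
Definition cuboid A B C D E F G H : Prop :=
  [/\ rectangle A B C D,
      [/\ A != E, dotp (B - A) (E - A) = 0 & dotp (D - A) (E - A) = 0] &
      [/\ F - B = E - A, G - C = E - A & H - D = E - A]].

Definition rational_face_cuboid A B C D E F G H : Prop :=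
  [/\ cuboid A B C D E F G H,
      [/\ rational (dist B F), rational (dist E F) & rational (dist F G)],
      [/\ rational (dist B E) & rational (dist H F)] &
      rational (dist D F)].

End Cuboid.

(* Main.v *)
(** Put [BF = a = 2|t|], [EF = b = |t^2 - 1|], [FG = c].  Then [BE = t^2 + 1], and
    [HF^2 = gamma] makes [DF^2 = a^2 + gamma = t^2 (s + 1/s)^2], so everything rests
    on [c^2 = gamma - b^2 = (s^2 - t^2)(t^2 - 1/s^2)] being a positive square.  The
    substitution defining [t] turns the four linear factors into constants times
    [alpha], [alpha - (2s)^2], [alpha + (s^2-1)^2] and [1] over the denominator of
    [t], which yields [c = 2 |(s^4 - 1) beta| / den^2].  For the degenerate values,
    [den = 0] and [t = 0] would make [beta^2] negative, [beta = 0] gives a point of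
    order 2, and [t = 1], [t = -1] give points whose double is [((2s)^2, 0)]. *)
Require Import Defs.
From mathcomp Require Import all_boot all_order all_algebra.
From mathcomp Require Import reals.
From mathcomp Require Import ring lra.

Import Order.TTheory GRing.Theory Num.Theory.
Local Open Scope ring_scope.

(** * The cubic of the curve and its points of order 2 and 4 *)

Lemma E1E (s : rat) :
  E1 s = 'X^3 + ((s ^+ 2 - 1) ^+ 2 - (2 * s) ^+ 2)%:P * 'X^2
         - ((2 * s) ^+ 2 * (s ^+ 2 - 1) ^+ 2)%:P * 'X.
Proof. by rewrite /E1 polyCB polyCM; ring. Qed.

Lemma E1N (s : rat) : E1 (- s) = E1 s.
Proof. by rewrite /E1 mulrN !sqrrN. Qed.

Lemma horner_E1 (s x : rat) :
  (E1 s).[x] = x * (x - (2 * s) ^+ 2) * (x + (s ^+ 2 - 1) ^+ 2).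
Proof. by rewrite /E1 !hornerE. Qed.

Lemma coef2_E1 (s : rat) : (E1 s)`_2 = (s ^+ 2 - 1) ^+ 2 - (2 * s) ^+ 2.
Proof. by rewrite E1E coefB coefD !coefCM !coefXn coefX /=; ring. Qed.

Lemma deriv_E1 (s x : rat) :
  (E1 s)^`().[x] = 3 * x ^+ 2 + 2 * ((s ^+ 2 - 1) ^+ 2 - (2 * s) ^+ 2) * x
                   - (2 * s) ^+ 2 * (s ^+ 2 - 1) ^+ 2.
Proof. by rewrite E1E !derivE !hornerE /=; ring. Qed.

Lemma ec_torsion2 (K : fieldType) (f : {poly K}) (x : K) :
  ec_torsion f (ECaff x 0).
Proof. by exists 2%N; rewrite // /ec_mul /= eqxx oppr0 eqxx. Qed.

(** This is the abscissa at which t = 1. The tangent at P meets the curve again at T = ((2s)^2, 0),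
    of order 2, so 2P = T; then P + T = -P and 4P = 0. *)
Lemma ec_torsion4 (s beta : rat) (x := 2 * s * (s + 1) ^+ 2) :
    s != 0 -> s != -1 -> on_curve (E1 s) (ECaff x beta) ->
  ec_torsion (E1 s) (ECaff x beta).
Proof.
move=> s0 sN1; rewrite /on_curve horner_E1 => hb.
have s1 : s + 1 != 0 by rewrite addr_eq0.
have s21 : s ^+ 2 + 1 != 0 by apply/eqP; nra.
(* The cubic is a perfect square at [x]; the sign [e] covers both square roots at once. *)
have [e e2 eb] : exists2 e : rat, e ^+ 2 = 1
    & beta = e * (2 * s * (s + 1) ^+ 2 * (s ^+ 2 + 1)).
  have /eqP : beta ^+ 2 = (2 * s * (s + 1) ^+ 2 * (s ^+ 2 + 1)) ^+ 2.
    by rewrite hb /x; ring.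
  rewrite eqf_sqr => /orP[] /eqP ->; [exists 1|exists (-1)];
    by rewrite ?sqrrN ?expr1n ?mul1r ?mulN1r.
have e0 : e != 0 by apply/eqP => e0; move: e2; rewrite e0; lra.
have b0 : beta != 0 by rewrite eb !mulf_neq0 ?expf_neq0.
have bN : beta != - beta by apply/eqP => bN; move/eqP: b0; apply; lra.
have ie : e^-1 = e.
  by apply: (mulfI e0); rewrite mulfV // -expr2 e2.
have xs : x - (2 * s) ^+ 2 != 0.
  suff -> : x - (2 * s) ^+ 2 = 2 * s * (s ^+ 2 + 1) by rewrite !mulf_neq0.
  by rewrite /x; ring.
have dbl : ec_add (E1 s) (ECaff x beta) (ECaff x beta) = ECaff ((2 * s) ^+ 2) 0.
  rewrite /ec_add eqxx /= (negPf bN) /ec_chord deriv_E1 coef2_E1.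
  have -> : (3 * x ^+ 2 + 2 * ((s ^+ 2 - 1) ^+ 2 - (2 * s) ^+ 2) * x
      - (2 * s) ^+ 2 * (s ^+ 2 - 1) ^+ 2) / (2 * beta) = e * (s + 1) ^+ 2.
    (* With [e^-1] on the right the equality is an identity of rational functions, free of
       [e ^+ 2 = 1]. *)
    rewrite eb -[X in _ = X * _]ie /x; field.
    by rewrite ?e0 ?s0 ?s1 ?s21.
  have -> : (e * (s + 1) ^+ 2) ^+ 2 - ((s ^+ 2 - 1) ^+ 2 - (2 * s) ^+ 2) - x - x
     = (2 * s) ^+ 2 by rewrite exprMn e2 /x; ring.
  by congr ECaff; rewrite eb /x; ring.
(* The chord through P and T is the tangent at P: same slope, and the third intersection is P
   itself. *)
have tpl : ec_add (E1 s) (ECaff x beta) (ECaff ((2 * s) ^+ 2) 0)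
    = ECaff x (- beta).
  rewrite /ec_add -subr_eq0 xs /ec_chord coef2_E1.
  have -> : (0 - beta) / ((2 * s) ^+ 2 - x) = e * (s + 1) ^+ 2.
    rewrite eb /x; field.
    by rewrite -oppr_eq0 opprB.
  have -> : (e * (s + 1) ^+ 2) ^+ 2 - ((s ^+ 2 - 1) ^+ 2 - (2 * s) ^+ 2) - x
     - (2 * s) ^+ 2 = x by rewrite exprMn e2 /x; ring.
  by rewrite subrr mulr0 sub0r.
exists 4%N => //; set P := ECaff x beta.
have -> : ec_mul (E1 s) 4 P
    = ec_add (E1 s) P (ec_add (E1 s) P (ec_add (E1 s) P P)) by [].
by rewrite dbl tpl /ec_add /= eqxx opprK eqxx.
Qed.

(** * Boxes in coordinates *)

Definition vec3 {R : realType} (x y z : R) : 'rV[R]_3 :=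
  \row_i [:: x; y; z]`_i.

Lemma vec3B (R : realType) (x y z x' y' z' : R) :
  vec3 x y z - vec3 x' y' z' = vec3 (x - x') (y - y') (z - z').
Proof. by apply/rowP => -[[|[|[|//]]] i]; rewrite !mxE. Qed.

Lemma dotp_vec3 (R : realType) (x y z x' y' z' : R) :
  dotp (vec3 x y z) (vec3 x' y' z') = x * x' + y * y' + z * z'.
Proof. by rewrite /dotp !big_ord_recl big_ord0 !mxE /= addr0 addrA. Qed.

Lemma neq_vec3 (R : realType) (x y z x' y' z' : R) :
  [|| x != x', y != y' | z != z'] -> vec3 x y z != vec3 x' y' z'.
Proof.
apply: contraTneq => /rowP e; have := e 0; have := e 1; have := e 2.
by rewrite !mxE /= => -> -> ->; rewrite !eqxx.
Qed.

Lemma cuboid_exists (R : realType) (a b c : R) : 0 < a -> 0 < b -> 0 < c ->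
  exists A B C D E F G H : 'rV[R]_3,
    [/\ cuboid A B C D E F G H,
        [/\ dist B F = a, dist E F = b & dist F G = c],
        [/\ dist B E = Num.sqrt (a ^+ 2 + b ^+ 2)
          & dist H F = Num.sqrt (b ^+ 2 + c ^+ 2)] &
        dist D F = Num.sqrt (a ^+ 2 + (b ^+ 2 + c ^+ 2))].
Proof.
move=> a0 b0 c0.
have sq (x y : R) : 0 < x -> y = x ^+ 2 -> Num.sqrt y = x.
  by move=> x0 ->; rewrite sqrtr_sqr gtr0_norm.
(* F is the origin; B, E, G lie on the axes at distances [a], [b], [c]. *)
exists (vec3 a b 0), (vec3 a 0 0), (vec3 a 0 c), (vec3 a b c).
exists (vec3 0 b 0), (vec3 0 0 0), (vec3 0 0 c), (vec3 0 b c).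
rewrite /cuboid /rectangle /dist !vec3B !dotp_vec3.
split; [split; split| |split; congr Num.sqrt|congr Num.sqrt];
  rewrite ?neq_vec3 ?(gt_eqF a0) ?(gt_eqF b0) ?(lt_eqF c0) ?orbT //;
  try ring; try by congr vec3; ring.
by split; apply: sq => //; ring.
Qed.

(** * Rational edges and diagonals *)

Lemma sqrD1_gt0 (s : rat) : 0 < s ^+ 2 + 1.
Proof. by rewrite ltr_wpDl ?sqr_ge0. Qed.

Lemma sqr_neqN (x y : rat) : y != 0 -> x ^+ 2 != - y ^+ 2.
Proof.
move=> y0; rewrite gt_eqF // (lt_le_trans _ (sqr_ge0 x)) // oppr_lt0.
by rewrite exprn_even_gt0.
Qed.

Lemma face_diagonalE (t : rat) :
  (2 * `|t|) ^+ 2 + `|t ^+ 2 - 1| ^+ 2 = (t ^+ 2 + 1) ^+ 2.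
Proof. by rewrite exprMn !real_normK ?num_real //; ring. Qed.

Lemma space_diagonalE (s t : rat) : s != 0 ->
  (2 * `|t|) ^+ 2 + t ^+ 2 * (s - 1 / s) ^+ 2 = (t * (s + 1 / s)) ^+ 2.
Proof. by move=> s0; rewrite exprMn real_normK ?num_real //; field. Qed.

Section FaceCuboid.
Variables s alpha beta : rat.
Hypotheses (s0 : s != 0) (s1 : s != 1) (sN1 : s != -1).
Hypothesis hE : on_curve (E1 s) (ECaff alpha beta).
Hypothesis hnt : ~ ec_torsion (E1 s) (ECaff alpha beta).

Let den := alpha + 2 * s ^+ 2 * (s ^+ 2 - 1).
Let t := (s * alpha - 2 * s * (s ^+ 2 - 1)) / den.

Let hb : beta ^+ 2 = alpha * (alpha - (2 * s) ^+ 2) * (alpha + (s ^+ 2 - 1) ^+ 2).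
Proof. by rewrite -horner_E1. Qed.

Let s21 : s ^+ 2 + 1 != 0.
Proof. by rewrite gt_eqF ?sqrD1_gt0. Qed.

Let s2B1 : s ^+ 2 - 1 != 0.
Proof. by rewrite subr_eq0 sqrf_eq1 negb_or s1. Qed.

Lemma beta_neq0 : beta != 0.
Proof. by apply/eqP => b0; apply: hnt; rewrite b0; apply: ec_torsion2. Qed.

Lemma den_neq0 : den != 0.
Proof.
apply/eqP => d0; have ea : alpha = - (2 * s ^+ 2 * (s ^+ 2 - 1)).
  by apply/eqP; rewrite -addr_eq0 -/den d0.
(* The factors of the cubic become -2s^2(s^2-1), -2s^2(s^2+1) and -(s^2-1)(s^2+1). *)
have : beta ^+ 2 != - (2 * s ^+ 2 * (s ^+ 2 - 1) * (s ^+ 2 + 1)) ^+ 2.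
  by rewrite sqr_neqN // !mulf_neq0 ?expf_neq0.
by case/eqP; rewrite hb ea; ring.
Qed.

Lemma t_neq0 : t != 0.
Proof.
rewrite mulf_neq0 ?invr_eq0 ?den_neq0 //; apply/eqP => d0.
have ea : alpha = 2 * (s ^+ 2 - 1).
  by apply: (mulfI s0); apply/eqP; rewrite -subr_eq0; apply/eqP; rewrite -d0; ring.
have : beta ^+ 2 != - (2 * (s ^+ 2 - 1) * (s ^+ 2 + 1)) ^+ 2.
  by rewrite sqr_neqN // !mulf_neq0 ?expf_neq0.
by case/eqP; rewrite hb ea; ring.
Qed.

Lemma t_neq1 : t != 1.
Proof.
apply/eqP => /(canRL (mulfVK den_neq0)); rewrite mul1r => e.
(* Numerator minus [den] is (s-1)(alpha - 2s(s+1)^2). *)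
have ea : alpha = 2 * s * (s + 1) ^+ 2.
  have s1' : s - 1 != 0 by rewrite subr_eq0.
  apply: (mulfI s1'); apply/eqP; rewrite -subr_eq0; apply/eqP.
  by move/eqP: e; rewrite -subr_eq0 => /eqP <-; rewrite /den; ring.
by apply: hnt; move: hE; rewrite ea; apply: ec_torsion4.
Qed.

(* The curve depends only on [s ^+ 2], and [t] is odd in [s]. *)
Lemma t_neqN1 : t != -1.
Proof.
apply/eqP => /(canRL (mulfVK den_neq0)); rewrite mulN1r => e.
have ea : alpha = 2 * - s * (- s + 1) ^+ 2.
  have s1' : s + 1 != 0 by rewrite addr_eq0.
  apply: (mulfI s1'); apply/eqP; rewrite -subr_eq0; apply/eqP.
  by move/eqP: e; rewrite -subr_eq0 => /eqP <-; rewrite /den; ring.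
apply: hnt; move: hE; rewrite ea -E1N; apply: ec_torsion4.
  by rewrite oppr_eq0.
by rewrite eqr_opp.
Qed.

Let c := 2 * `|(s ^+ 2 - 1) * (s ^+ 2 + 1) * beta| / den ^+ 2.

Lemma face_edge_gt0 : 0 < c.
Proof.
rewrite divr_gt0 ?[0 < den ^+ 2]exprn_even_gt0 ?den_neq0 //.
by rewrite mulr_gt0 ?normr_gt0 ?mulf_neq0 ?beta_neq0.
Qed.

(** Multiplied by [den], the factors s-t, s+t, t-1/s, t+1/s are 2s(s^4-1), 2s(alpha+(s^2-1)^2),
    (s-1/s)(alpha-(2s)^2), (s+1/s)alpha, with product 4(s^4-1)^2 beta^2. *)
Lemma face_edgeE : `|t ^+ 2 - 1| ^+ 2 + c ^+ 2 = t ^+ 2 * (s - 1 / s) ^+ 2.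
Proof.
have -> : c ^+ 2 = 4 * (s ^+ 2 - 1) ^+ 2 * (s ^+ 2 + 1) ^+ 2 * beta ^+ 2 / den ^+ 4.
  rewrite /c !exprMn exprVn -exprM real_normK ?num_real // !exprMn.
  by congr (_ / _); ring.
rewrite real_normK ?num_real // hb /t /den; field.
by rewrite s0 den_neq0.
Qed.

Lemma edge_lengths_gt0 : 0 < 2 * `|t| /\ 0 < `|t ^+ 2 - 1|.
Proof.
by rewrite mulr_gt0 ?normr_gt0 ?t_neq0 // subr_eq0 sqrf_eq1 negb_or t_neq1 t_neqN1.
Qed.

End FaceCuboid.

(** * Passage from rational to real lengths *)

Lemma rational_ratr (R : realType) (q : rat) : rational (ratr q : R).
Proof. by exists q. Qed.

Lemma sqrt_ratr_sqr (R : realType) (q : rat) :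
  Num.sqrt (ratr (q ^+ 2) : R) = ratr `|q|.
Proof. by rewrite rmorphXn /= sqrtr_sqr -ratr_norm. Qed.

Theorem theorem1p1 (R : realType) (s alpha beta : rat)
    (hs0 : s != 0) (hs1 : s != 1) (hsN1 : s != -1)
    (hE : on_curve (E1 s) (ECaff alpha beta))
    (hnt : ~ ec_torsion (E1 s) (ECaff alpha beta)) :
  let t := (s * alpha - 2 * s * (s ^+ 2 - 1))
             / (alpha + 2 * s ^+ 2 * (s ^+ 2 - 1)) in
  let gamma := t ^+ 2 * (s - 1 / s) ^+ 2 in
  exists A B C D E F G H : 'rV[R]_3,
    [/\ rational_face_cuboid A B C D E F G H,
        dist B F = ratr (2 * `|t|),
        dist E F = ratr `|t ^+ 2 - 1| &
        dist H F = Num.sqrt (ratr gamma)].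
Proof.
move=> t gamma.
have [a0 b0] := edge_lengths_gt0 _ _ _ hs0 hs1 hsN1 hE hnt.
have c0 := face_edge_gt0 _ _ _ hs0 hs1 hsN1 hE hnt.
have hc := face_edgeE _ _ _ hs0 hs1 hsN1 hE.
rewrite -/t in a0 b0 hc.
move: a0 b0 c0; rewrite -!(ltr0q R) => a0 b0 c0.
have := cuboid_exists R _ _ _ a0 b0 c0.
(* Gathering each radicand under one [ratr] lets the identities over Q apply; [hc] comes first
   because b^2 + c^2 also occurs inside the radicand of DF. *)
rewrite -!rmorphXn -!rmorphD hc face_diagonalE space_diagonalE // -/gamma.
rewrite !sqrt_ratr_sqr.
case=> A [B [C [D [E [F [G [H [cub [eBF eEF eFG] [eBE eHF] eDF]]]]]]]].
have rHF : rational (dist H F).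
  by rewrite eHF /gamma -exprMn sqrt_ratr_sqr; apply: rational_ratr.
exists A, B, C, D, E, F, G, H; split=> //.
split=> //; [split|split=> //|];
  by rewrite ?eBF ?eEF ?eFG ?eBE ?eDF; apply: rational_ratr.
Qed.
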